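(* For every positive integer $n$, let $F(n)$ be the number of faces in a random embedding of the complete graph $K_n$. Then $\mathbb{E}[F(n)]>\tfrac12\ln(n)-2$.
   Context: A rotation system of a graph $G$ is a choice, for each vertex $v$, of a cyclic permutation $R_v$ (a single cycle) of the darts at $v$, where a dart is a pair $(v,e)$ with $e$ an edge incident with $v$. Let $R$ be the product of all $R_v$, and let $L$ be the fixed-point-free involution on the set of all darts that swaps the two darts $(u,e),(v,e)$ of each edge $e=uv$. Rotation systems correspond to (equivalence classes of) 2-cell embeddings of a connected graph $G$ in oriented closed surfaces; the faces of the embedding are the cycles of $R\circ L$ (the one-vertex graph without edges has one face). A random embedding of $G$ is one given by a rotation system chosen uniformly at random among all $\prod_{v}(\deg(v)-1)!$ rotation systems. *)

(* Defs.v *)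
From HB Require Import structures.
From mathcomp Require Import all_boot all_order all_algebra all_fingroup.
From mathcomp Require Import reals exp.

Set Implicit Arguments.
Unset Strict Implicit.
Unset Printing Implicit Defensive.

Import Order.TTheory GRing.Theory Num.Theory.

Local Open Scope ring_scope.

Record sgraph := SGraph {
  svertex :> finType;
  adj : rel svertex;
  adj_sym : symmetric adj;
  adj_irr : irreflexive adj }.

Lemma complete_adj_sym n : symmetric [rel i j : 'I_n | i != j].
Proof. by move=> i j /=; rewrite eq_sym. Qed.

Lemma complete_adj_irr n : irreflexive [rel i j : 'I_n | i != j].
Proof. by move=> i /=; rewrite eqxx. Qed.

Definition complete_graph (n : nat) : sgraph :=
  SGraph (@complete_adj_sym n) (@complete_adj_irr n).

Section RotationSystems.
Variable G : sgraph.

(* As G is simple, the dart (v, e) with e = vw is encoded by the ordered pair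
   (v, w) of adjacent vertices. *)
Definition dart : finType := {d : G * G | adj d.1 d.2}.

Definition darts_at (v : G) : {set dart} := [set d : dart | (val d).1 == v].

Lemma flip_subproof (d : dart) : adj (val d).2 (val d).1.
Proof. by rewrite adj_sym; apply: (valP d). Qed.

Definition flip_dart (d : dart) : dart :=
  exist (fun p : G * G => adj p.1 p.2) ((val d).2, (val d).1)
    (flip_subproof d).

Lemma flip_dartK : involutive flip_dart.
Proof. by move=> d; apply: val_inj; case: d => -[u v] ?. Qed.

Definition flip : {perm dart} := perm (inv_inj flip_dartK).

Definition is_cyclic_perm_of (A : {set dart}) (s : {perm dart}) : bool :=
  perm_on A s && [forall d in A, porbit s d == A].

Definition rotation_systems : {set {ffun G -> {perm dart}}} :=
  [set r : {ffun G -> {perm dart}} |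
    [forall v, is_cyclic_perm_of (darts_at v) (r v)]].

(* The factors have pairwise disjoint supports, so their order is
   irrelevant. *)
Definition rotation_perm (r : {ffun G -> {perm dart}}) : {perm dart} :=
  (\prod_(v : G) r v)%g.

(* Permutations compose from left to right, so flip * rotation_perm r is the
   map R o L. Meaningful for connected G only; the one-vertex graph, which has
   no darts, has one face. *)
Definition num_faces (r : {ffun G -> {perm dart}}) : nat :=
  if #|G| == 1%N then 1%N else #|porbits (flip * rotation_perm r)%g|.

End RotationSystems.

Definition uniform_expectation (R : realType) (T : finType) (A : {set T})
    (X : T -> nat) : R :=
  (\sum_(x in A) (X x)%:R) / #|A|%:R.

Definition expected_faces (R : realType) (G : sgraph) : R :=
  uniform_expectation R (rotation_systems G) (@num_faces G).

(* Main.v *)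
Require Import Defs.
From HB Require Import structures.
From mathcomp Require Import all_boot all_order all_algebra all_fingroup.
From mathcomp Require Import reals exp.
From mathcomp Require Import ring lra.

Import Order.TTheory GRing.Theory Num.Theory.

Local Open Scope ring_scope.

(** A cycle of length [k >= 3] in a simple graph bounds a face with probability
    [\prod_v 1 / (deg v - 1)]: at each vertex [v] of the cycle the rotation must
    send one given dart to another given dart, and by symmetry all [deg v - 1]
    candidates for the image are equally likely. In [K_n] there are
    [n (n-1) ... (n-k+1) / k] directed [k]-cycles, so the expected number of
    faces is at least the sum over [3 <= k <= K] of
    [(1/k) n (n-1) ... (n-k+1) / (n-2)^k]. Each term is at least
    [(1/k) (1 - (k-2)(k-3) / (2(n-2)))]; taking [K] to be the integer part of
    [sqrt n], the harmonic sum contributes at least [ln (sqrt n) - 3/2] and the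
    correction costs at most [1/4]. *)

(** * Orbits and single-cycle permutations *)

Lemma porbit_conjg (T : finType) (s p : {perm T}) x :
  porbit (s ^ p)%g (p x) = p @: porbit s x.
Proof.
have conjX i : ((s ^ p) ^+ i)%g (p x) = p ((s ^+ i)%g x).
  by rewrite -conjXg /conjg !permM permK.
apply/setP=> y; apply/porbitP/imsetP=> [[i ->]|[_ /porbitP[i ->] ->]].
  by exists ((s ^+ i)%g x); rewrite ?mem_porbit.
by exists i.
Qed.

Lemma porbit_fcycle (T : finType) (s : {perm T}) (c : seq T) x :
  uniq c -> fcycle s c -> x \in c -> porbit s x =i c.
Proof.
move=> Uc sc xc y; rewrite -(fconnect_cycle sc xc).
apply/porbitP/idP => [[i ->]|/iter_findex <-]; first by rewrite permX fconnect_iter.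
by exists (findex s x y); rewrite permX.
Qed.

Section CyclicPerms.
Variables (G : sgraph) (A : {set dart G}).

Definition cyclic_perms : {set {perm dart G}} := [set s | is_cyclic_perm_of A s].

(** The successor map along [enum A] is a witness; it fixes everything outside [A]. *)
Lemma cyclic_perms_gt0 : (0 < #|cyclic_perms|)%N.
Proof.
have Ue : uniq (enum A) by apply: enum_uniq.
pose s := perm (can_inj (prev_next Ue)).
apply/card_gt0P; exists s; rewrite inE; apply/andP; split.
  apply/subsetP=> x; rewrite inE permE => /eqP nextx; apply/contraT => xA.
  by case: nextx; rewrite next_nth mem_enum (negPf xA).
apply/forall_inP=> x xA; apply/eqP/setP=> y.
rewrite (@porbit_fcycle _ s (enum A)) ?mem_enum //.
by rewrite (eq_cycle (e' := frel (next (enum A)))) ?cycle_next // => u v /=; rewrite permE.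
Qed.

Lemma is_cyclic_perm_of_conjg (p s : {perm dart G}) :
  perm_on A p -> is_cyclic_perm_of A (s ^ p)%g = is_cyclic_perm_of A s.
Proof.
have conj q u : perm_on A q -> is_cyclic_perm_of A u -> is_cyclic_perm_of A (u ^ q)%g.
  move=> qA /andP[uA /forall_inP u_cyc]; apply/andP; split.
    by rewrite !perm_onM ?perm_onV.
  apply/forall_inP=> d dA; apply/eqP.
  have q'dA : (q^-1)%g d \in A by rewrite perm_closed ?perm_onV.
  rewrite -[d](permKV q) porbit_conjg (eqP (u_cyc _ q'dA)).
  by apply/im_perm_on.
move=> pA; apply/idP/idP; last exact: conj.
by move/(conj _ _ (perm_onV pA)); rewrite conjgK.
Qed.

(** Conjugating by the transposition of [y] and [z], which fixes [x], matches the permutations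
    sending [x] to [y] with those sending [x] to [z], so all [#|A|.-1] images of [x] are equally
    frequent. *)
Lemma card_cyclic_perms_through x y :
    x \in A -> y \in A -> x != y ->
  (#|[set s in cyclic_perms | s x == y]| * #|A|.-1 = #|cyclic_perms|)%N.
Proof.
move=> xA yA xy.
(* If [s] fixed [x], the orbit of [x] would miss [y]. *)
have moves s : s \in cyclic_perms -> s x \in A :\ x.
  rewrite !inE => /andP[sA /forall_inP s_cyc]; rewrite perm_closed // xA andbT.
  apply: contraNneq xy => sx; have /eqP := s_cyc _ xA.
  move/setP/(_ y); rewrite yA => /porbitP[i ->]; rewrite permX.
  by elim: i => //= i /eqP <-; rewrite sx.
have same z : z \in A :\ x ->
    #|[set s in cyclic_perms | s x == z]| = #|[set s in cyclic_perms | s x == y]|.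
  rewrite !inE => /andP[zx zA].
  have yzA : perm_on A (tperm y z).
    apply/subsetP=> d; rewrite inE; apply: contraNT => dA.
    by rewrite tpermD //; apply: contraNneq dA => <-.
  rewrite -(card_preimset _ (conjg_inj (tperm y z))); apply: eq_card => s.
  rewrite !inE is_cyclic_perm_of_conjg //; congr (_ && _).
  have tx : tperm y z x = x by rewrite tpermD // eq_sym.
  by rewrite /conjg !permM tpermV tx (can2_eq (tpermK y z) (tpermK y z)) tpermR.
rewrite (cardsD1 x A) xA add1n /= mulnC -sum_nat_const.
rewrite -(eq_bigr _ same) -[RHS]sum1_card.
rewrite [RHS](partition_big (fun s : {perm dart G} => s x) (mem (A :\ x))) //=.
by apply: eq_bigr => z _; rewrite -sum1_card; apply: eq_bigl => s; rewrite inE.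
Qed.

End CyclicPerms.

(** If both neighbours of [x] coincide, two steps of [next] lead back to [x], which distinct entries
    allow only in length at most 2. *)
Lemma next_prev_neq (T : eqType) (c : seq T) x :
  uniq c -> (2 < size c)%N -> x \in c -> prev c x != next c x.
Proof.
move=> Uc c_gt2 xc; have nextpx := next_prev Uc x.
apply/eqP => pn; rewrite pn in nextpx.
have [i q def_q] := rot_to xc.
move: nextpx c_gt2; rewrite -!(next_rot i Uc) -(size_rot i c).
rewrite -(rot_uniq i) in Uc; rewrite {}def_q /= in Uc *.
case: q Uc => [|a [|b q]] //=; rewrite !inE eqxx.
case: (eqVneq x a) => //= xa; case: (eqVneq x b) => //= xb _.
by rewrite eqxx => bx; rewrite bx eqxx in xb.
Qed.

(** * Faces along simple cycles *)

Section SimpleCycleFaces.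
Variable G : sgraph.
Implicit Types (t : seq G) (r : {ffun G -> {perm dart G}}).

(** Each factor fixes the darts away from its vertex and keeps the others at it, so only the factor
    at its own vertex can move a dart. *)
Lemma rotation_permE r (d : dart G) :
  r \in rotation_systems G -> rotation_perm r d = r (val d).1 d.
Proof.
rewrite inE => /forallP r_cyc.
have fixes v (e : dart G) : (val e).1 != v -> r v e = e.
  have /andP[/subsetP r_on _] := r_cyc v.
  by move=> ev; apply: contraNeq ev => re; have := r_on e re; rewrite inE.
have stays v (e : dart G) : (val (r v e)).1 = (val e).1.
  have [ev|/fixes-> //] := eqVneq (val e).1 v.
  have /andP[r_on _] := r_cyc v.
  by have := perm_closed e r_on; rewrite !inE ev eqxx => /eqP.
have prodE l (e : dart G) : uniq l ->
    (\prod_(v <- l) r v)%g e = if (val e).1 \in l then r (val e).1 e else e.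
  elim: l e => [|v l IHl] e /=; first by rewrite big_nil perm1.
  move=> /andP[vl Ul]; rewrite big_cons permM IHl // stays inE.
  have [ev|ev] := eqVneq (val e).1 v; last by rewrite (fixes v).
  by rewrite ev (negPf vl).
by rewrite /rotation_perm prodE ?index_enum_uniq // mem_index_enum.
Qed.

Definition face_perm r : {perm dart G} := (flip G * rotation_perm r)%g.

(* With [turns] at every vertex of [t], the walk arriving along [(prev t v, v)]
   leaves along [(v, next t v)], so [t] is the tail sequence of a face. *)
Definition turns t v (s : {perm dart G}) : bool :=
  (v \in t) ==> [forall d : dart G, (val d == (v, prev t v)) ==>
                   (val (s d) == (v, next t v))].

Definition facial t r : bool := [forall v, turns t v (r v)].

(** Flipping [d] gives the dart at [next t x] pointing back to [x], and [turns] prescribes its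
    image. *)
Lemma facial_step t r x (d : dart G) :
    r \in rotation_systems G -> uniq t -> facial t r -> x \in t ->
    val d = (x, next t x) ->
  val (face_perm r d) = (next t x, next t (next t x)).
Proof.
move=> rR Ut /forallP/(_ (next t x)) + xt dx.
rewrite /turns mem_next xt => /forallP/(_ (flip_dart d)).
rewrite prev_next //= dx eqxx => /eqP <-.
by rewrite permM permE rotation_permE //= dx.
Qed.

Lemma facial_face t r x (d : dart G) :
    r \in rotation_systems G -> uniq t -> facial t r -> ohead t = Some x ->
    val d = (x, next t x) ->
  #|porbit (face_perm r) d| = size t
  /\ [seq (val e).1 | e <- traject (face_perm r) d (size t)] = t.
Proof.
move=> rR Ut ft + dx; case Dt: {1}t => [//|y q] [yx]; subst y.
have xt : x \in t by rewrite Dt mem_head.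
have in_t i : iter i (next t) x \in t by elim: i => //= i; rewrite mem_next.
have iterE i : val (iter i (face_perm r) d) = (iter i (next t) x, iter i.+1 (next t) x).
  by elim: i => //= i /(facial_step _ _ _ _ rR Ut ft (in_t i)).
have sz_t : size t = (size q).+1 by rewrite Dt.
have: fcycle (next t) t by apply: cycle_next.
rewrite {2}Dt /= => /fpathE; rewrite size_rcons => rconsE.
have loop : iter (size t) (next t) x = x.
  by rewrite -last_traject sz_t -rconsE last_rcons.
have trajE : [seq (val e).1 | e <- traject (face_perm r) d (size t)] = t.
  have ->: [seq (val e).1 | e <- traject (face_perm r) d (size t)]
         = traject (next t) x (size t).
    apply: (@eq_from_nth _ x); rewrite size_map !size_traject // => i i_lt.
    by rewrite (nth_map d) ?size_traject // !nth_traject // iterE.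
  rewrite sz_t /=; move: rconsE; rewrite trajectSr => /rcons_inj[<- _].
  by rewrite Dt.
split; last exact: trajE.
rewrite -[RHS](size_traject (face_perm r) d (size t)).
(* The tails are the distinct entries of [t], so no dart recurs before the walk closes. *)
have Uf : uniq (traject (face_perm r) d (size t)).
  by apply: (@map_uniq _ _ (fun e => (val e).1)); rewrite trajE.
rewrite -(card_uniqP Uf); apply: eq_card; apply: porbit_fcycle => //; last by rewrite sz_t mem_head.
rewrite sz_t /=.
have loop_d : iter (size q) (face_perm r) (face_perm r d) = d.
  apply: val_inj; rewrite -iterSr -sz_t iterE iterS.
  by rewrite loop -dx.
by rewrite -[X in rcons _ X]loop_d -trajectSr fpath_traject.
Qed.

Definition simple_cycle t : bool := path.cycle (@adj G) t && uniq t.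

(* A facial cycle is the first [k] tails on the face of its starting dart, so
   it is determined by that dart, and the face has length [k]. *)
Lemma card_facial_cycles r k : r \in rotation_systems G -> (0 < k)%N ->
  (#|[set t : k.-tuple G | simple_cycle t && facial t r]|
     <= k * #|[set P in porbits (face_perm r) | #|P| == k]|)%N.
Proof.
move=> rR k_gt0; pose s := face_perm r.
have tails_size d : size [seq (val e).1 | e <- traject s d k] == k.
  by rewrite size_map size_traject.
pose tails d : k.-tuple G := Tuple (tails_size d).
pose D := [set d : dart G | #|porbit s d| == k].
have sub_tails : [set t : k.-tuple G | simple_cycle t && facial t r] \subset tails @: D.
  apply/subsetP=> t; rewrite inE => /andP[/andP[adj_t Ut] ft].
  have sz_t : size t = k by rewrite size_tuple.
  case Dt: (val t) (sz_t) => [|x q] sz_q; first by rewrite -sz_q in k_gt0.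
  have xt : x \in val t by rewrite Dt mem_head.
  pose d : dart G := exist _ (x, next t x) (next_cycle adj_t xt).
  have hd_t : ohead (val t) = Some x by rewrite Dt.
  have [size_d tails_d] := facial_face _ _ _ d rR Ut ft hd_t erefl.
  rewrite sz_t in size_d tails_d.
  apply/imsetP; exists d; first by rewrite inE size_d.
  by apply: val_inj; rewrite /= tails_d.
apply: leq_trans (subset_leq_card sub_tails) _.
apply: leq_trans (leq_imset_card _ _) _.
set O := [set P in _ | _].
have D_cover : D \subset cover O.
  apply/subsetP=> d; rewrite inE => /eqP d_k.
  apply/bigcupP; exists (porbit s d); last exact: porbit_id.
  by rewrite inE d_k eqxx andbT imset_f.
apply: leq_trans (subset_leq_card D_cover) _.
apply: leq_trans (leq_card_cover O).1 _.
rewrite (eq_bigr (fun=> k)) => [|P]; last by rewrite inE => /andP[_ /eqP].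
by rewrite sum_nat_const mulnC.
Qed.

(** * Counting rotation systems and the expected number of faces *)

(** Rotations at different vertices are independent choices, so the counts for vertexwise conditions
    multiply. *)
Lemma card_rotation_systems_where (Q : G -> pred {perm dart G}) :
  #|[set r in rotation_systems G | [forall v, Q v (r v)]]|
    = (\prod_(v : G) #|[set s in cyclic_perms G (darts_at v) | Q v s]|)%N.
Proof.
have := card_family (fun v : G => mem [set s in cyclic_perms G (darts_at v) | Q v s]).
rewrite foldrE big_map big_enum /= => {1}<-; apply: eq_card => r; rewrite !inE.
apply/andP/familyP => [[/forallP r_cyc /forallP rQ] v|rF].
  by rewrite !inE r_cyc rQ.
by split; apply/forallP=> v; have := rF v; rewrite !inE => /andP[].
Qed.

Lemma card_rotation_systems :
  #|rotation_systems G| = (\prod_(v : G) #|cyclic_perms G (darts_at v)|)%N.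
Proof.
have := card_rotation_systems_where (fun _ => predT).
have -> : [set r in rotation_systems G | [forall v, predT (r v)]] = rotation_systems G.
  by apply/setP=> r; rewrite !inE; apply/andb_idr => _; apply/forallP.
by move=> ->; apply: eq_bigr => v _; apply: eq_card => s; rewrite !inE andbT.
Qed.

(** At each vertex of [t] the image of one dart is prescribed, which leaves a fraction
    [1 / (deg v - 1)] of the rotations; the other vertices are free. *)
Lemma card_facial_rotations t : simple_cycle t -> (2 < size t)%N ->
  (#|[set r in rotation_systems G | facial t r]| * \prod_(v <- t) #|darts_at v|.-1
     = #|rotation_systems G|)%N.
Proof.
move=> /andP[adj_t Ut] t_gt2.
rewrite (card_rotation_systems_where (fun v => turns t v)) card_rotation_systems.
rewrite (big_uniq _ Ut) [X in (_ * X)%N]big_mkcond -big_split; apply: eq_bigr => v _ /=.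
have [vt|vt] := boolP (v \in t); last first.
  by rewrite muln1; apply: eq_card => s; rewrite !inE /turns (negPf vt) andbT.
pose dp : dart G := flip_dart (exist _ (prev t v, v) (prev_cycle adj_t vt)).
pose dn : dart G := exist _ (v, next t v) (next_cycle adj_t vt).
(* The two darts differ because [t] has length at least 3. *)
rewrite -(@card_cyclic_perms_through G (darts_at v) dp dn) ?inE //=; last first.
  by rewrite -val_eqE xpair_eqE negb_and next_prev_neq ?orbT.
congr (_ * _)%N; apply: eq_card => s; rewrite !inE /turns vt /=; congr (_ && _).
apply/forallP/eqP => [/(_ dp)|sd d].
  by rewrite eqxx => /eqP ?; apply: val_inj.
by apply/implyP => /eqP dv; rewrite (_ : d = dp) ?sd //; apply: val_inj.
Qed.

(** Linearity of expectation; [1/k] accounts for the [k] starting points of a directed cycle. *)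
Lemma expected_faces_ge_cycles (R : realType) K : #|G| != 1%N ->
  \sum_(3 <= k < K) k%:R^-1 * (\sum_(t : k.-tuple G | simple_cycle t)
      \prod_(v <- t) (#|darts_at v|.-1)%:R^-1) <= expected_faces R G.
Proof.
move=> G_neq1; rewrite /expected_faces /uniform_expectation.
set RS := rotation_systems G.
have RS_gt0 : (0 < #|RS|)%N.
  by rewrite /RS card_rotation_systems prodn_gt0 // => v; apply: cyclic_perms_gt0.
rewrite ler_pdivlMr ?ltr0n // mulr_suml.
have faces_ge (r : {ffun G -> {perm dart G}}) : r \in RS ->
    \sum_(3 <= k < K) k%:R^-1 * (\sum_(t : k.-tuple G | simple_cycle t) (facial t r)%:R)
      <= (num_faces r)%:R :> R.
  move=> rR; rewrite /num_faces (negPf G_neq1) -/(face_perm r).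
  set PS := porbits _.
  apply: (@le_trans _ _ (\sum_(3 <= k < K) #|[set P in PS | #|P| == k]|%:R)).
    rewrite big_nat_cond [leRHS]big_nat_cond; apply: ler_sum => k.
    rewrite andbT => /andP[k_gt2 _]; have k_gt0 : (0 < k)%N by apply: leq_trans k_gt2.
    rewrite ler_pdivrMl ?ltr0n // -natrM -natr_sum ler_nat.
    apply: leq_trans (card_facial_cycles r k rR k_gt0).
    rewrite -sum1_card big_mkcond [leqRHS]big_mkcond; apply: leq_sum => t _.
    by rewrite inE; case: simple_cycle; case: facial.
  rewrite -natr_sum ler_nat.
  (* A face has one length only, so it is counted at most once. *)
  have -> : (\sum_(3 <= k < K) #|[set P in PS | #|P| == k]|
      = \sum_(P in PS) \sum_(3 <= k < K) (k == #|P|))%N.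
    rewrite exchange_big; apply: eq_bigr => k _; rewrite -sum1_card big_mkcond.
    rewrite [RHS]big_mkcond; apply: eq_bigr => P _.
    by rewrite inE eq_sym; case: (P \in PS); case: (k == _).
  rewrite -[leqRHS]sum1_card; apply: leq_sum => P _.
  rewrite -big_mkcond /= sum1_count.
  by rewrite (count_uniq_mem #|P| (iota_uniq _ _)); case: (_ \in _).
apply: le_trans (ler_sum _ faces_ge).
rewrite exchange_big /= big_nat_cond [leRHS]big_nat_cond; apply: ler_sum => k.
rewrite andbT => /andP[k_gt2 _].
rewrite -mulrA -mulr_sumr ler_wpM2l ?invr_ge0 ?ler0n //.
rewrite exchange_big mulr_suml; apply: ler_sum => t t_cyc.
have t_gt2 : (2 < size t)%N by rewrite size_tuple.
have cardE := card_facial_rotations t t_cyc t_gt2.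
(* By [cardE], a zero product would leave no rotation system. *)
have prod_neq0 : (\prod_(v <- t) #|darts_at v|.-1)%:R != 0 :> R.
  by rewrite pnatr_eq0; apply: contraTneq RS_gt0 => p0; rewrite /RS -cardE p0 muln0.
rewrite prodfV -natr_prod -cardE mulrC natrM mulfK // -natr_sum ler_nat.
rewrite -sum1_card big_mkcond [leqRHS]big_mkcond; apply: leq_sum => r _.
by rewrite inE; case: (r \in _); case: facial.
Qed.

End SimpleCycleFaces.

(** * Logarithm and falling factorial estimates *)

Lemma ln_succ_le (R : realType) (k : nat) : (0 < k)%N ->
  ln (k.+1%:R : R) <= ln (k%:R : R) + k%:R^-1.
Proof.
move=> k_gt0; have k_pos : 0 < k%:R :> R by rewrite ltr0n.
have -> : k.+1%:R = k%:R * (1 + k%:R^-1) :> R.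
  by rewrite mulrDr mulr1 divff ?gt_eqF // -natr1.
have kV : 0 < k%:R^-1 :> R by rewrite invr_gt0.
rewrite lnM ?posrE ?addr_gt0 //.
by rewrite lerD2l le_ln1Dx //; lra.
Qed.

(** Since the ratio never exceeds 1, multiplying it by [1 - j/m] loses at most [j/m]; these losses
    add up to [j (j-1) / (2 m)]. *)
Lemma ffact_ratio_ge (R : realFieldType) (m j : nat) : (0 < m)%N ->
  1 - (j * j.-1)%:R / (2 * m%:R) <= (m ^_ j)%:R / m%:R ^+ j :> R.
Proof.
move=> m_gt0; have m_pos : 0 < m%:R :> R by rewrite ltr0n.
have a_le1 i : (m ^_ i)%:R / m%:R ^+ i <= 1 :> R.
  rewrite ler_pdivrMr ?exprn_gt0 // mul1r -natrX ler_nat.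
  elim: i => // i IHi; rewrite ffactnSr expnSr; apply: leq_mul => //.
  exact: leq_subr.
have a_ge0 i : 0 <= (m ^_ i)%:R / m%:R ^+ i :> R.
  by rewrite divr_ge0 ?exprn_ge0 ?ler0n.
elim: j => [|j IHj]; first by rewrite mul0n mul0r subr0 ffactn0 expr0 divr1.
rewrite ffactnSr exprSr (natrM _ (m ^_ j)).
(* Only an inequality, as the subtraction on the right is truncated. *)
have sub_ge : m%:R - j%:R <= (m - j)%N%:R :> R.
  by rewrite lerBlDr -natrD ler_nat addnC -leq_subLR.
have -> : (m ^_ j)%:R * (m - j)%:R / (m%:R ^+ j * m%:R)
        = (m ^_ j)%:R / m%:R ^+ j * ((m - j)%:R / m%:R) :> R.
  by rewrite invfM mulrACA.
apply: (@le_trans _ _ ((m ^_ j)%:R / m%:R ^+ j * (1 - j%:R / m%:R))); last first.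
  by rewrite ler_wpM2l // -{1}(divff (lt0r_neq0 m_pos)) -mulrBl ler_pM2r ?invr_gt0.
rewrite mulrBr mulr1.
have jm_ge0 : 0 <= j%:R / m%:R :> R by rewrite divr_ge0.
have : (m ^_ j)%:R / m%:R ^+ j * (j%:R / m%:R) <= j%:R / m%:R :> R.
  by rewrite ler_piMl.
have -> : (j.+1 * j.+1.-1)%:R / (2 * m%:R)
        = (j * j.-1)%:R / (2 * m%:R) + j%:R / m%:R :> R.
  have -> : (j.+1 * j.+1.-1)%:R = (j * j.-1)%:R + 2 * j%:R :> R.
    rewrite -natrM -natrD; congr _%:R; case: j {IHj sub_ge jm_ge0} => //= j.
    by rewrite [(j.+1 * j)%N]mulnC -mulnDl addn2.
  by field; rewrite gt_eqF.
by move: IHj => /=; lra.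
Qed.

(* (m+2)(m+1) >= m^2 absorbs the first two factors of the falling factorial. *)
Lemma ffactSS_ratio_ge (R : realFieldType) (m j : nat) : (0 < m)%N ->
  1 - (j * j.-1)%:R / (2 * m%:R) <= (m.+2 ^_ j.+2)%:R / m%:R ^+ j.+2 :> R.
Proof.
move=> m_gt0; have m_pos : 0 < m%:R :> R by rewrite ltr0n.
apply: le_trans (@ffact_ratio_ge R m j m_gt0) _.
rewrite ler_pdivlMr ?exprn_gt0 // -(addn2 j) exprD mulrA divfK ?expf_neq0 ?lt0r_neq0 //.
rewrite addn2 !ffactSS -natrX -natrM ler_nat mulnA mulnC leq_mul2r -mulnn.
by rewrite leq_mul ?orbT // ltnW.
Qed.

(** The harmonic part of each new term pays for the growth of the logarithm; its correction is at
    most [L / (2 m)], and these sum to the quadratic term. *)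
Lemma sum_cycles_ge_ln (R : realType) (m L : nat) : (0 < m)%N ->
  ln (L.+3%:R : R) - 3 / 2 - L%:R * (L%:R - 1) / (4 * m%:R)
    <= \sum_(3 <= k < L.+3) k%:R^-1 * ((m.+2 ^_ k)%:R / m%:R ^+ k) :> R.
Proof.
move=> m_gt0; have m_pos : 0 < m%:R :> R by rewrite ltr0n.
elim: L => [|L IHL].
  rewrite big_geq // mul0r mul0r subr0.
  (* The constant comes from [ln 3 <= 1 + 1/2]. *)
  have := @ln_succ_le R 2 isT; have := @ln_succ_le R 1 isT.
  by rewrite ln1; lra.
have -> : L.+1%:R * (L.+1%:R - 1) / (4 * m%:R)
    = L%:R * (L%:R - 1) / (4 * m%:R) + L%:R / (2 * m%:R) :> R.
  by rewrite -natr1; field; rewrite gt_eqF.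
rewrite big_nat_recr //=; have := @ln_succ_le R L.+3 isT.
have := @ffactSS_ratio_ge R m L.+1 m_gt0.
set a := _ / m%:R ^+ _; rewrite /= => a_ge.
have : L.+3%:R^-1 * (1 - (L.+1 * L)%:R / (2 * m%:R)) <= L.+3%:R^-1 * a :> R.
  by rewrite ler_wpM2l // invr_ge0.
have : L.+3%:R^-1 * ((L.+1 * L)%:R / (2 * m%:R)) <= L%:R / (2 * m%:R) :> R.
  rewrite natrM -mulrA mulrA ler_piMl ?divr_ge0 ?mulr_ge0 //.
  rewrite ler_pdivrMl ?ltr0n //.
  by rewrite mulr1 ler_nat; do 2 apply: leqW.
rewrite mulrBr mulr1; move: IHL.
have lin (S ca c u v w l3 l4 : R) : l3 - 3 / 2 - w <= S -> u <= v -> c - u <= ca ->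
  l4 <= l3 + c -> l4 - 3 / 2 - (w + v) <= S + ca by lra.
exact: lin.
Qed.

(** [L.+2] is the integer square root of [n] and will be the largest cycle length used. *)
Lemma exists_sqrt_between n : (4 <= n)%N ->
  exists L, (L.+2 ^ 2 <= n < L.+3 ^ 2)%N.
Proof.
elim: n => // n IHn; rewrite leq_eqVlt => /predU1P[<-|]; first by exists 0%N.
move=> /IHn[L /andP[Ln nL]].
have [lt|ge] := ltnP n.+1 (L.+3 ^ 2); first by exists L; rewrite lt leqW.
exists L.+1; rewrite ge /=; apply: leq_ltn_trans nL _.
by rewrite ltn_sqr.
Qed.

(** * Complete graphs *)

Lemma card_darts_at_complete n (v : complete_graph n) : #|darts_at v| = n.-1.
Proof.
pose head (d : dart (complete_graph n)) := (val d).2.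
have head_inj : {in darts_at v &, injective head}.
  move=> d e; rewrite !inE => /eqP dv /eqP ev de; apply: val_inj.
  by rewrite [val d]surjective_pairing [val e]surjective_pairing dv ev; congr (_, _).
rewrite -(card_in_imset head_inj) -[n in RHS]card_ord -(cardsC1 v).
apply: eq_card => w; rewrite !inE; apply/imsetP/idP => [[d]|wv].
  by rewrite inE => /eqP <- ->; rewrite eq_sym; apply: (valP d).
have vw : @adj (complete_graph n) v w by rewrite /= eq_sym.
by exists (exist _ (v, w) vw); rewrite ?inE.
Qed.

Lemma simple_cycle_complete n (t : seq (complete_graph n)) :
  (2 < size t)%N -> simple_cycle (complete_graph n) t = uniq t.
Proof.
move=> t_gt2; apply: andb_idl => Ut.
apply: (sub_in_cycle (P := mem t)) (cycle_next Ut); last by apply/allP.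
move=> x y xt _ /= /eqP <-; have := next_prev_neq _ _ _ Ut t_gt2 xt.
by apply: contra_neq => xn; rewrite {1}xn prev_next.
Qed.

Lemma expected_faces_complete_ge (R : realType) (m K : nat) :
  \sum_(3 <= k < K) k%:R^-1 * ((m.+2 ^_ k)%:R / m%:R ^+ k)
    <= expected_faces R (complete_graph m.+2).
Proof.
apply: le_trans (expected_faces_ge_cycles _ R K _); last by rewrite card_ord.
rewrite big_nat_cond [leRHS]big_nat_cond le_eqVlt; apply/orP; left; apply/eqP.
apply: eq_bigr => k /andP[/andP[k_gt2 _] _]; congr (_ * _).
rewrite (eq_bigr (fun=> m%:R ^- k)) => [|t _]; last first.
  under eq_bigr => v _ do rewrite card_darts_at_complete.
  by rewrite big_const_seq iter_mulr_1 count_predT size_tuple exprVn.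
(* Simple cycles are just the duplicate-free tuples, counted by the falling factorial. *)
rewrite sumr_const mulr_natl -[in LHS](card_ord m.+2) -card_uniq_tuples; congr (_ *+ _).
apply: eq_card => t; rewrite inE all_predT.
by symmetry; apply: (simple_cycle_complete m.+2 t); rewrite size_tuple.
Qed.

Theorem theorem1p6 (R : realType) (n : nat) (hn : (0 < n)%N) :
  expected_faces R (complete_graph n) > 1 / 2 * ln (n%:R : R) - 2.
Proof.
(* For [n <= 4] the bound is negative, as [ln n < n <= 4]. *)
have [n_le4|n_gt4] := leqP n 4.
  have E_ge0 : 0 <= expected_faces R (complete_graph n).
    by rewrite divr_ge0 ?sumr_ge0.
  have : n%:R <= 4 :> R by rewrite ler_nat.
  have : ln (n%:R : R) < n%:R by rewrite ln_sublinear ?ltr0n.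
  lra.
have [L /andP[L_n n_L]] := exists_sqrt_between n (ltnW n_gt4).
case: n => [|[|m]] // in n_gt4 L_n n_L hn *.
have m_gt0 : (0 < m)%N by case: (m) n_gt4.
have m_pos : 0 < m%:R :> R by rewrite ltr0n.
(* [(L+2)^2 <= m+2] gives [L (L-1) <= m]. *)
have loss : L%:R * (L%:R - 1) / (4 * m%:R) <= 1 / 4 :> R.
  rewrite ler_pdivrMr ?mulr_gt0 //.
  have : (L.+2 ^ 2)%:R <= m.+2%:R :> R by rewrite ler_nat.
  have : 0 <= L%:R :> R by [].
  rewrite natrX -(addn2 L) -(addn2 m) !natrD; nra.
have ln_n : ln (m.+2%:R : R) <= 2 * ln (L.+3%:R : R).
  rewrite mulr_natl -lnXn ?ltr0n // ler_ln ?posrE ?exprn_gt0 ?ltr0n //.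
  by rewrite -natrX ler_nat ltnW.
(* The total is at least [ln n / 2 - 3/2 - 1/4], which leaves a margin of [1/4]. *)
have := sum_cycles_ge_ln R m L m_gt0.
have := expected_faces_complete_ge R m L.+3.
lra.
Qed.
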